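(* Let the kernel $f$ have a polynomial score of degree $p\ge1$ relative to $S:\mathcal X\to\mathbb R^q$, and suppose that $q<d_2$, where $\Theta\subset\mathbb R^{d_2}$. Then there exists a non-empty open set $U\subseteq\Theta^\circ$ on which $f$ satisfies a non-trivial parameter PDE.
   Context: Standing setting. The sample space $\mathcal X$ is a Borel subset of $\mathbb R^{d_1}$ with a $\sigma$-finite Borel measure $\lambda$ (understood to be Lebesgue measure for continuous kernels and counting measure for discrete ones). The parameter space $\Theta\subset\mathbb R^{d_2}$ is compact and equal to the closure of its interior $\Theta^\circ$, which is non-empty. A kernel is a jointly measurable function $f:\mathcal X\times\Theta\to[0,\infty)$, written $f(x\mid\theta)$, with $\int_{\mathcal X}f(x\mid\theta)\,\lambda(dx)=1$ for every $\theta\in\Theta$. Polynomial score. The kernel $f$ has a polynomial score of degree $p\ge1$ relative to $S=(S_1,\ldots,S_q):\mathcal X\to\mathbb R^q$ if $\theta\mapsto f(x\mid\theta)$ is infinitely differentiable on $\Theta^\circ$ for every $x\in\mathcal X$, $f(x\mid\theta)>0$ for all $x\in\mathcal X$, $\theta\in\Theta^\circ$, and, for each $j\in\{1,\ldots,d_2\}$, $$\frac{\partial_{\theta_j}f(x\mid\theta)}{f(x\mid\theta)}=P_j(S(x);\theta),\qquad x\in\mathcal X,\ \theta\in\Theta^\circ,$$ where $P_j(\cdot\,;\theta)$ is a polynomial in $q$ variables of total degree at most $p$ whose coefficients are infinitely differentiable functions of $\theta\in\Theta^\circ$. For a multi-index $\alpha\in\mathbb N_0^{d_2}$, $|\alpha|=\alpha_1+\cdots+\alpha_{d_2}$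 and $\partial_\theta^\alpha=\partial^{|\alpha|}/\partial\theta_1^{\alpha_1}\cdots\partial\theta_{d_2}^{\alpha_{d_2}}$ (the identity when $|\alpha|=0$). Parameter differential operator. For $U\subseteq\Theta^\circ$ open and $r\in\mathbb N_0$, a parameter differential operator on $U$ of order $r$ is a map $\mathcal L_\theta$ acting on functions $w\in C^r(U)$ by $\mathcal L_\theta w=\sum_{|\alpha|\le r}c_\alpha(\theta)\,\partial_\theta^\alpha w$, $\theta\in U$, with coefficients $c_\alpha\in C^{|\alpha|}(U)$. It is non-trivial on a set $A\subseteq U$ if $c_\alpha$ is not identically zero on $A$ for at least one $\alpha$ with $|\alpha|\ge 1$. The kernel $f$ satisfies a non-trivial parameter PDE on $U$ if there is a parameter differential operator $\mathcal L_\theta$ on $U$ of some order $r$, non-trivial on $U$, such that $\mathcal L_\theta f(x\mid\theta)=0$ for $\lambda$-almost every $x\in\mathcal X$ and every $\theta\in U$. *)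

(* Defs.v *)
From HB Require Import structures.
From mathcomp Require Import all_boot all_order all_algebra.
From mathcomp Require Import all_classical all_reals all_analysis.
(* Only the notations of multinomials clash with those of analysis. *)
From mathcomp.multinomials Require Export -(notations) mpoly.
Import Order.TTheory GRing.Theory Num.Theory.
Import numFieldNormedType.Exports.

Set Implicit Arguments.
Unset Strict Implicit.
Unset Printing Implicit Defensive.

Local Open Scope classical_set_scope.
Local Open Scope ring_scope.

(* 'rV[R]_n with the sigma-algebra generated by its open sets. *)
Notation borel_rV R n := (g_sigma_algebraType (@open 'rV[R]_n)).

Section partial_derivatives.
Context {R : realType} {n : nat}.
Implicit Types (U : set 'rV[R]_n) (w : 'rV[R]_n -> R) (a : multinom n).

Definition basis_vec (j : 'I_n) : 'rV[R]_n := delta_mx 0 j.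

Definition partial (j : 'I_n) w : 'rV[R]_n -> R :=
  fun t => derive w t (basis_vec j).

(* Membership in C^k(U), for U open: every iterated partial derivative of
   order at most k exists and is continuous at each point of U.  Functions are
   total, but only their values on U matter since U is open. *)
Fixpoint is_Ck (k : nat) U w : Prop :=
  (forall t, U t -> {for t, continuous w}) /\
  if k is k'.+1 then
    forall j, (forall t, U t -> derivable w t (basis_vec j)) /\
              is_Ck k' U (partial j w)
  else True.

Definition is_Coo U w : Prop := forall k, is_Ck k U w.

Definition mpartial a w : 'rV[R]_n -> R :=
  foldr (fun j g => iter (a j) (partial j) g) w (enum 'I_n).

End partial_derivatives.

Section parameter_pde.
Context {R : realType} {n : nat}.

(* bmultinom n r.+1 is the finite type of multi-indices a with mdeg a <= r. *)
Record param_diff_op (U : set 'rV[R]_n) (r : nat) := ParamDiffOp {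
  pdo_coef : bmultinom n r.+1 -> 'rV[R]_n -> R ;
  pdo_coef_Ck : forall a : bmultinom n r.+1, is_Ck (mdeg a) U (pdo_coef a) }.

Definition pdo_app U r (L : param_diff_op U r) (w : 'rV[R]_n -> R)
    : 'rV[R]_n -> R :=
  fun t => \sum_(a : bmultinom n r.+1) pdo_coef L a t * mpartial a w t.

Definition pdo_nontrivial U r (L : param_diff_op U r) (A : set 'rV[R]_n) :=
  exists a : bmultinom n r.+1,
    (1 <= mdeg a)%N /\ exists2 t, A t & pdo_coef L a t != 0.

End parameter_pde.

Section kernels.
Context {R : realType} {d1 d2 : nat}.
Implicit Types (X : set (borel_rV R d1)) (Theta U : set 'rV[R]_d2).
Implicit Types (lambda : {measure set (borel_rV R d1) -> \bar R}).
Implicit Types (f : 'rV[R]_d1 -> 'rV[R]_d2 -> R).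

(* A Borel measure on X is represented by a measure on R^d1 of which only the
   restriction to X is ever used. *)
Definition sample_space X lambda : Prop :=
  measurable X /\ sigma_finite X lambda.

Definition parameter_space Theta : Prop :=
  [/\ compact Theta, Theta = closure Theta° & Theta° !=set0].

(* Only the values of f on X * Theta matter. *)
Definition is_kernel X lambda Theta f : Prop :=
  [/\ measurable_fun (X `*` Theta : set (borel_rV R d1 * borel_rV R d2)%type)
        (fun z => f z.1 z.2),
      forall x t, X x -> Theta t -> 0 <= f x t &
      forall t, Theta t -> (\int[lambda]_(x in X) (f x t)%:E = 1)%E].

(* P j t is the polynomial P_j(.; t); its total degree is (msize _).-1. *)
Definition has_polynomial_score X Theta f (q : nat)
    (S : 'rV[R]_d1 -> 'rV[R]_q) (p : nat) : Prop :=
  [/\ (1 <= p)%N,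
      forall x, X x -> is_Coo Theta° (f x),
      forall x t, X x -> Theta° t -> 0 < f x t &
      exists P : 'I_d2 -> 'rV[R]_d2 -> mpoly q R,
        [/\ forall j t, Theta° t -> (msize (P j t) <= p.+1)%N,
            forall j (m : multinom q),
              is_Coo Theta° (fun t => mcoeff m (P j t)) &
            forall j x t, X x -> Theta° t ->
              partial j (f x) t / f x t = meval (fun i => S x 0 i) (P j t)]].

(* The exceptional null set does not depend on t. *)
Definition satisfies_param_pde X lambda U f : Prop :=
  exists (r : nat) (L : param_diff_op U r),
    pdo_nontrivial L U /\
    {ae lambda, forall x, X x ->
       is_Ck r U (f x) /\ forall t, U t -> pdo_app L (f x) t = 0}.

End kernels.

(* Main.v *)
Require Import Defs.
From HB Require Import structures.
From mathcomp Require Import all_boot all_order all_algebra.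
From mathcomp Require Import all_classical all_reals all_analysis.
Import Order.TTheory GRing.Theory Num.Theory.
Import numFieldNormedType.Exports.
Local Open Scope classical_set_scope.
Local Open Scope ring_scope.

(** The score identity [partial j (f x) = f x * P_j (S x)] propagates to all
orders: differentiating [f x * Q (S x)], where [Q] is a polynomial in the
statistic with smooth coefficients in the parameter, gives
[f x * (P_j * Q + partial j Q) (S x)], so each derivative costs at most [p] in
degree.  Hence every derivative of [f x] of order at most [r] is [f x] times a
polynomial of degree at most [r * p] in the [q] components of [S x]
([poly_multiple_mpartial]).

There are of order [r ^ d2] such derivatives, but only of order [r ^ q]
monomials in the statistic, and [q < d2]: for large [r] there are more
derivatives than monomials ([more_derivatives_than_monomials]).  The coefficient
vectors of the polynomials are therefore linearly dependent at each parameter.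
Gaussian elimination, shrinking the open set at each step so that the pivot does
not vanish on it and avoiding division, makes the dependence smooth in the
parameter ([smooth_dependence]).  The coefficients so found annihilate [f x] for
every [x].  They cannot be carried by order zero alone, since [f x] is positive,
so the operator is non-trivial. *)

(** * Smooth functions on an open set *)

Section smooth_functions.
Context {R : realType} {n : nat}.
Implicit Types (U V : set 'rV[R]_n) (v w : 'rV[R]_n -> R).

Lemma partial_near j v w (t : 'rV[R]_n) :
  (\near t, v t = w t) -> partial j v t = partial j w t.
Proof. exact: (near_eq_derive (basis_vec j)). Qed.

Lemma continuous_near v w (t : 'rV[R]_n) :
  (\near t, v t = w t) -> {for t, continuous v} -> {for t, continuous w}.
Proof.
move=> vw; rewrite /prop_for /continuous_at -(nbhs_singleton vw) => vc.
exact: cvg_trans (near_eq_cvg vw) vc.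
Qed.

(** The partial derivatives are those of total functions, so agreement on [U] is
passed on to derivatives only because [U] is open. *)
Lemma is_Ck_eq k U v w : open U -> (forall t, U t -> v t = w t) ->
  is_Ck k U v -> is_Ck k U w.
Proof.
move=> Uo.
have vw_near v' w' t : (forall t, U t -> v' t = w' t) -> U t ->
    \near t, v' t = w' t.
  by move=> vw Ut; near=> s; apply: vw; near: s; exact: open_nbhs_nbhs.
elim: k v w => [|k IH] v w vw [vc vd].
  by split=> // t Ut; apply: continuous_near (vc t Ut); exact: vw_near.
split=> [t Ut|j]; first by apply: continuous_near (vc t Ut); exact: vw_near.
have [vj vk] := vd j; split=> [t Ut|].
  by apply: near_eq_derivable (vj t Ut); exact: vw_near.
by apply: IH vk => t Ut; apply: partial_near; exact: vw_near.
Unshelve. all: by end_near. Qed.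

Lemma is_Ck_sub k U V w : V `<=` U -> is_Ck k U w -> is_Ck k V w.
Proof.
move=> VU; elim: k w => [|k IH] w [wc wd].
  by split=> // t /VU; apply: wc.
split=> [t /VU|j]; first exact: wc.
by have [wj wk] := wd j; split=> [t /VU|]; [exact: wj|exact: IH].
Qed.

Lemma is_CkW k U w : is_Ck k.+1 U w -> is_Ck k U w.
Proof.
elim: k w => [|k IH] w [wc wd]; first by split.
by split=> // j; have [wj /IH wk] := wd j; split.
Qed.

Lemma is_Ck_cst k U (a : R) : is_Ck k U (fun=> a).
Proof.
elim: k a => [|k IH] a; first by split=> // t _; exact: cst_continuous.
split=> [t _|j]; first exact: cst_continuous.
split=> [t _|]; first exact: derivable_cst.
by have -> : partial j (fun=> a) = fun=> 0; [apply/funext => t; exact: derive_cst|].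
Qed.

Lemma is_CkD k U v w : open U ->
  is_Ck k U v -> is_Ck k U w -> is_Ck k U (fun t => v t + w t).
Proof.
move=> Uo; elim: k v w => [|k IH] v w [vc vd] [wc wd].
  by split=> // t Ut; apply: continuousD; [exact: vc|exact: wc].
split=> [t Ut|j]; first by apply: continuousD; [exact: vc|exact: wc].
have [vj vk] := vd j; have [wj wk] := wd j.
split=> [t Ut|]; first by apply: derivableD; [exact: vj|exact: wj].
apply: is_Ck_eq (IH _ _ vk wk) => // t Ut.
by rewrite /partial -deriveD //; [exact: vj|exact: wj].
Qed.

Lemma partialM j v w (t : 'rV[R]_n) :
  derivable v t (basis_vec j) -> derivable w t (basis_vec j) ->
  partial j (fun t => v t * w t) t = v t * partial j w t + w t * partial j v t.
Proof. exact: deriveM. Qed.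

Lemma is_CkM k U v w : open U ->
  is_Ck k U v -> is_Ck k U w -> is_Ck k U (fun t => v t * w t).
Proof.
move=> Uo; elim: k v w => [|k IH] v w [vc vd] [wc wd].
  by split=> // t Ut; apply: continuousM; [exact: vc|exact: wc].
split=> [t Ut|j]; first by apply: continuousM; [exact: vc|exact: wc].
have [vj vk] := vd j; have [wj wk] := wd j.
split=> [t Ut|]; first by apply: derivableM; [exact: vj|exact: wj].
have vk' : is_Ck k U v by apply: is_CkW; split.
have wk' : is_Ck k U w by apply: is_CkW; split.
apply: is_Ck_eq (is_CkD k U _ _ Uo (IH _ _ vk' wk) (IH _ _ wk' vk)) => // t Ut.
by rewrite partialM //; [exact: vj|exact: wj].
Qed.

Lemma is_Coo_sub U V w : V `<=` U -> is_Coo U w -> is_Coo V w.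
Proof. by move=> VU wU k; apply: is_Ck_sub VU (wU k). Qed.

Lemma is_Coo_cst U (a : R) : is_Coo U (fun=> a).
Proof. by move=> k; apply: is_Ck_cst. Qed.

Lemma is_CooD U v w : open U ->
  is_Coo U v -> is_Coo U w -> is_Coo U (fun t => v t + w t).
Proof. by move=> Uo vU wU k; apply: is_CkD. Qed.

Lemma is_CooM U v w : open U ->
  is_Coo U v -> is_Coo U w -> is_Coo U (fun t => v t * w t).
Proof. by move=> Uo vU wU k; apply: is_CkM. Qed.

Lemma is_CooB U v w : open U ->
  is_Coo U v -> is_Coo U w -> is_Coo U (fun t => v t - w t).
Proof.
move=> Uo vU wU; have -> : (fun t => v t - w t) = (fun t => v t + (-1) * w t).
  by apply/funext => t; rewrite mulN1r.
by apply: is_CooD => //; apply: is_CooM => //; apply: is_Coo_cst.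
Qed.

Lemma is_Coo_sum (I : Type) (s : seq I) (P : pred I) U (w : I -> 'rV[R]_n -> R) :
  open U -> (forall i, is_Coo U (w i)) ->
  is_Coo U (fun t => \sum_(i <- s | P i) w i t).
Proof.
move=> Uo wU; elim: s => [|i s IH].
  have -> : (fun t => \sum_(i <- [::] | P i) w i t) = fun=> 0.
    by apply/funext => t; rewrite big_nil.
  exact: is_Coo_cst.
have [Pi|Pi] := boolP (P i).
  have -> : (fun t => \sum_(j <- i :: s | P j) w j t) =
            (fun t => w i t + \sum_(j <- s | P j) w j t).
    by apply/funext => t; rewrite big_cons Pi.
  exact: is_CooD.
rewrite (_ : (fun t => _) = (fun t => \sum_(j <- s | P j) w j t)) //.
by apply/funext => t; rewrite big_cons (negbTE Pi).
Qed.

Lemma is_Coo_partial j U w : is_Coo U w -> is_Coo U (partial j w).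
Proof. by move=> wU k; have [_ /(_ j)[]] := wU k.+1. Qed.

Lemma is_Coo_derivable j U w (t : 'rV[R]_n) :
  is_Coo U w -> U t -> derivable w t (basis_vec j).
Proof. by move=> /(_ 1%N)[_ /(_ j)[wj _]]; apply: wj. Qed.

Lemma open_nonvanishing U w :
  open U -> is_Coo U w -> open (U `&` [set t | w t != 0]).
Proof.
move=> Uo wU; rewrite openE => t [Ut wt].
apply: filterI; first exact: open_nbhs_nbhs.
have [/(_ t Ut) wc _] := wU 0%N.
apply: (wc [set y | y != 0]).
by apply: open_nbhs_nbhs; split=> //; exact: open_neq.
Qed.

(** * Smooth linear dependence *)

(** Fraction-free Gaussian elimination over smooth functions, by induction on the
number of columns.  These functions have zero divisors, so a pivot must be
nowhere zero to be cancelled: this is why the dependence is found only on a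
smaller open set. *)
Lemma smooth_dependence (I J : finType) (v : I -> J -> 'rV[R]_n -> R)
    (A : {set I}) (B : {set J}) U :
  open U -> U !=set0 -> (forall i j, is_Coo U (v i j)) -> (#|B| < #|A|)%N ->
  exists V (c : I -> 'rV[R]_n -> R),
    [/\ open V, V `<=` U, forall i, is_Coo V (c i),
        exists i t, [/\ i \in A, V t & c i t != 0] &
        forall t j, V t -> j \in B -> \sum_(i in A) c i t * v i j t = 0].
Proof.
move Ek : #|B| => k.
elim: k A B Ek U v => [|k IH] A B Ek U v Uo [t0 Ut0] vU BA.
  have [i iA] : exists i, i \in A by apply/card_gt0P.
  exists U, (fun _ _ => 1); split=> // [i'||t j _].
  - exact: is_Coo_cst.
  - by exists i, t0; rewrite oner_neq0.
  - by rewrite (cards0_eq Ek) inE.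
have [j jB] : exists j, j \in B by apply/card_gt0P; rewrite Ek.
have EBj : #|B :\ j| = k by move: Ek; rewrite (cardsD1 j) jB => -[].
have [[i [t1 [iA Ut1 vt1]]]|] :=
    pselect (exists i t, [/\ i \in A, U t & v i j t != 0]); last first.
  (* The column [j] vanishes on [U] and can be dropped. *)
  move=> vj0.
  have [V [c [Vo VU cV c0 cv]]] :=
    IH A (B :\ j) EBj U v Uo (ex_intro _ t0 Ut0) vU (ltnW BA).
  exists V, c; split=> // t j' Vt j'B.
  have [->|j'j] := eqVneq j' j; last by apply: cv => //; rewrite !inE j'j.
  rewrite big1 // => i iA; suff -> : v i j t = 0 by rewrite mulr0.
  by apply/eqP/negPn/negP => vn0; apply: vj0; exists i, t; split=> //; apply: VU.
pose W := U `&` [set t | v i j t != 0].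
have Wo : open W by apply: open_nonvanishing.
have WU : W `<=` U by move=> ? [].
have vW i' j' : is_Coo W (v i' j') by apply: is_Coo_sub (vU i' j').
(* Eliminate the column [j] with the pivot [v i j], without dividing by it. *)
pose v' i' j' t := v i j t * v i' j' t - v i' j t * v i j' t.
have v'W i' j' : is_Coo W (v' i' j') by apply: is_CooB => //; apply: is_CooM.
have kA : (k < #|A :\ i|)%N by move: BA; rewrite (cardsD1 i A) iA.
have [V [c [Vo VW cV [i1 [t2 [i1A Vt2 ct2]]] cv]]] :=
  IH (A :\ i) (B :\ j) EBj W v' Wo (ex_intro _ t1 (conj Ut1 vt1)) v'W kA.
have vV i' j' : is_Coo V (v i' j') by apply: is_Coo_sub (vW i' j').
(* The coefficient of the pivot row undoes the elimination; the other
   coefficients pick up the factor [v i j]. *)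
pose c' i' t := if i' == i then 0 - \sum_(i2 in A :\ i) c i2 t * v i2 j t
                else c i' t * v i j t.
exists V, c'; split=> //.
- exact: subset_trans WU.
- move=> i'; rewrite /c'; case: (i' == i); last exact: is_CooM.
  apply: is_CooB => //; first exact: is_Coo_cst.
  by apply: is_Coo_sum => // i2; apply: is_CooM.
- exists i1, t2; move: i1A; rewrite !inE => /andP[i1i i1A]; split=> //.
  by rewrite /c' (negbTE i1i) mulf_neq0 //; have [] := VW _ Vt2.
move=> t j' Vt j'B; rewrite (big_setD1 i) //= {1}/c' eqxx.
have -> : \sum_(i' in A :\ i) c' i' t * v i' j' t =
          \sum_(i' in A :\ i) c i' t * v i j t * v i' j' t.
  apply: eq_bigr => i'; rewrite !inE => /andP[/negbTE i'i _].
  by rewrite /c' i'i.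
rewrite sub0r mulNr mulr_suml -sumrN -big_split /=.
have [->|j'j] := eqVneq j' j.
  by rewrite big1 // => i' _; rewrite -!mulrA [v i' j t * _]mulrC addNr.
rewrite -[RHS](cv t j' Vt); last by rewrite !inE j'j.
apply: eq_bigr => i' _; rewrite /v' mulrBr !mulrA addrC; congr (_ - _).
Qed.

End smooth_functions.

(** * Polynomials in the statistic with smooth coefficients *)

Section polynomials_in_statistic.
Context {R : realType} {n q : nat} {T : Type}.
Context (X : set T) (S : T -> 'rV[R]_q) (U : set 'rV[R]_n).
Context (Uo : open U).
Implicit Types (g h : T -> 'rV[R]_n -> R).

Definition stat_monomial (m : multinom q) (x : T) : R :=
  \prod_(i < q) S x 0 i ^+ m i.

Lemma stat_monomialD m1 m2 x :
  stat_monomial (mnm_add m1 m2) x = stat_monomial m1 x * stat_monomial m2 x.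
Proof.
rewrite /stat_monomial -big_split /=; apply: eq_bigr => i _.
by rewrite mnmDE exprD.
Qed.

Definition smooth_poly_in (D : nat) g :=
  exists2 c : multinom q -> 'rV[R]_n -> R, forall m, is_Coo U (c m) &
    forall x t, X x -> U t ->
      g x t = \sum_(m : bmultinom q D.+1) c m t * stat_monomial m x.

Lemma smooth_poly_in_eq D g h :
  (forall x t, X x -> U t -> g x t = h x t) ->
  smooth_poly_in D g -> smooth_poly_in D h.
Proof.
by move=> gh [c cU gE]; exists c => // x t Xx Ut; rewrite -gh // gE.
Qed.

Lemma smooth_poly_in0 D : smooth_poly_in D (fun _ _ => 0).
Proof.
exists (fun _ _ => 0) => [m|x t _ _]; first exact: is_Coo_cst.
by rewrite big1 // => m _; rewrite mul0r.
Qed.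

Lemma smooth_poly_inD D g h : smooth_poly_in D g -> smooth_poly_in D h ->
  smooth_poly_in D (fun x t => g x t + h x t).
Proof.
move=> [c cU gE] [d dU hE]; exists (fun m t => c m t + d m t) => [m|x t Xx Ut].
  exact: is_CooD.
rewrite gE // hE // -big_split; apply: eq_bigr => m _; by rewrite mulrDl.
Qed.

Lemma smooth_poly_in_sum D (I : Type) (s : seq I) (g : I -> T -> 'rV[R]_n -> R) :
  (forall i, smooth_poly_in D (g i)) ->
  smooth_poly_in D (fun x t => \sum_(i <- s) g i x t).
Proof.
move=> gP; elim: s => [|i s IH].
  by apply: smooth_poly_in_eq (smooth_poly_in0 D) => x t _ _; rewrite big_nil.
apply: smooth_poly_in_eq (smooth_poly_inD D _ _ (gP i) IH) => x t _ _.
by rewrite big_cons.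
Qed.

(** Together with closure under sums, this reduces closure properties of
[smooth_poly_in] to monomials, and avoids collecting like terms. *)
Lemma smooth_poly_in_monomial D (m : multinom q) (c : 'rV[R]_n -> R) :
  (mdeg m <= D)%N -> is_Coo U c ->
  smooth_poly_in D (fun x t => c t * stat_monomial m x).
Proof.
move=> mD cU; exists (fun m' t => if m' == m then c t else 0) => [m'|x t Xx Ut].
  by case: (m' == m) => //; apply: is_Coo_cst.
have mD' : (mdeg m < D.+1)%N by [].
rewrite (bigD1 (BMultinom mD')) //= eqxx big1 ?addr0 // => m' m'm.
have /negbTE -> : bmnm m' != m by apply: contra m'm => /eqP m'm; exact/eqP/val_inj.
by rewrite mul0r.
Qed.

Lemma smooth_poly_inW D E g :
  (D <= E)%N -> smooth_poly_in D g -> smooth_poly_in E g.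
Proof.
move=> DE [c cU gE].
apply: (smooth_poly_in_eq E _ _ (fun x t Xx Ut => esym (gE x t Xx Ut))).
apply: smooth_poly_in_sum => m; apply: smooth_poly_in_monomial => //.
by apply: leq_trans DE; rewrite -ltnS bmdeg.
Qed.

Lemma smooth_poly_inM D E g h : smooth_poly_in D g -> smooth_poly_in E h ->
  smooth_poly_in (D + E) (fun x t => g x t * h x t).
Proof.
move=> [c cU gE] [d dU hE].
apply: (smooth_poly_in_eq _ (fun x t =>
    \sum_(m1 : bmultinom q D.+1) \sum_(m2 : bmultinom q E.+1)
      (c m1 t * d m2 t) * stat_monomial (mnm_add m1 m2) x)) => [x t Xx Ut|].
  rewrite gE // hE // big_distrlr /=.
  apply: eq_bigr => m1 _; apply: eq_bigr => m2 _.
  by rewrite stat_monomialD mulrACA.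
apply: smooth_poly_in_sum => m1; apply: smooth_poly_in_sum => m2.
apply: smooth_poly_in_monomial; last exact: is_CooM.
by rewrite mdegD leq_add // -ltnS bmdeg.
Qed.

Lemma partial_smooth_sum (I : Type) (s : seq I) (c : I -> 'rV[R]_n -> R)
    (a : I -> R) j t : (forall i, is_Coo U (c i)) -> U t ->
  partial j (fun t => \sum_(i <- s) c i t * a i) t =
  \sum_(i <- s) partial j (c i) t * a i.
Proof.
move=> cU Ut; have ciU i : is_Coo U (fun t => c i t * a i).
  by apply: is_CooM => //; apply: is_Coo_cst.
elim: s => [|i s IH].
  rewrite big_nil (_ : (fun t => _) = cst 0); first exact: derive_cst.
  by apply/funext => t'; rewrite big_nil.
rewrite (_ : (fun t => _) =
   (fun t => c i t * a i) + (fun t => \sum_(i <- s) c i t * a i)); last first.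
  by apply/funext => t'; rewrite big_cons.
rewrite [LHS]deriveD; first last.
- by apply: (is_Coo_derivable j U) => //; apply: is_Coo_sum.
- exact: (is_Coo_derivable j U).
rewrite big_cons; congr (_ + _); last exact: IH.
rewrite [LHS]partialM; last exact: derivable_cst; first last.
  exact: (is_Coo_derivable j U).
by rewrite [partial j (fun=> a i) t]derive_cst mulr0 add0r mulrC.
Qed.

Lemma smooth_poly_in_partial j D g :
  smooth_poly_in D g -> smooth_poly_in D (fun x => partial j (g x)).
Proof.
move=> [c cU gE]; exists (fun m => partial j (c m)) => [m|x t Xx Ut].
  exact: is_Coo_partial.
rewrite -(partial_smooth_sum _ _ (fun m : bmultinom q D.+1 => c m)) //.
apply: partial_near; near=> s; apply: gE => //; near: s.
exact: open_nbhs_nbhs.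
Unshelve. all: by end_near. Qed.

Lemma smooth_poly_in_derivable j D g x t :
  smooth_poly_in D g -> X x -> U t -> derivable (g x) t (basis_vec j).
Proof.
move=> [c cU gE] Xx Ut.
pose w t := \sum_(m : bmultinom q D.+1) c m t * stat_monomial m x.
apply: (@near_eq_derivable _ _ _ w).
  near=> s; rewrite gE //; near: s; exact: open_nbhs_nbhs.
apply: (is_Coo_derivable j U) => //; apply: is_Coo_sum => // m.
by apply: is_CooM => //; apply: is_Coo_cst.
Unshelve. all: by end_near. Qed.

(** ** Derivatives of a kernel with polynomial score *)

Context (f : T -> 'rV[R]_n -> R) (p : nat).
Context (f_smooth : forall x, X x -> is_Coo U (f x)).
Context (f_score : forall j, exists2 h, smooth_poly_in p h &
  forall x t, X x -> U t -> partial j (f x) t = f x t * h x t).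

Definition poly_multiple (D : nat) g :=
  exists2 h, smooth_poly_in D h &
    forall x t, X x -> U t -> g x t = f x t * h x t.

(** If [g = f * h] and [s] is the [j]-th score, then
[partial j g = f * (s * h + partial j h)]. *)
Lemma poly_multiple_partial j D g :
  poly_multiple D g -> poly_multiple (p + D) (fun x => partial j (g x)).
Proof.
move=> [h hP gE]; have [s sP fE] := f_score j.
exists (fun x t => s x t * h x t + partial j (h x) t) => [|x t Xx Ut].
  apply: smooth_poly_inD; first exact: smooth_poly_inM.
  by apply: (smooth_poly_inW D); [exact: leq_addl|exact: smooth_poly_in_partial].
rewrite (partial_near j _ (fun t => f x t * h x t)); last first.
  near=> t'; apply: gE => //; near: t'; exact: open_nbhs_nbhs.
rewrite partialM; last first.
- exact: smooth_poly_in_derivable hP Xx Ut.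
- exact: is_Coo_derivable (f_smooth x Xx) Ut.
by rewrite fE // mulrDr [LHS]addrC mulrCA [h x t * _]mulrC.
Unshelve. all: by end_near. Qed.

Lemma poly_multiple_mpartial a :
  poly_multiple (mdeg a * p) (fun x => mpartial a (f x)).
Proof.
rewrite mdegE /mpartial -[in X in poly_multiple X _]big_enum /=.
elim: (enum 'I_n) => [|j s IH] /=.
  rewrite big_nil mul0n; exists (fun _ _ => 1) => [|x t _ _]; last by rewrite mulr1.
  have /smooth_poly_in_eq : forall x t, X x -> U t ->
    (fun=> 1 : R) t * stat_monomial mnm0 x = 1.
    by move=> x t _ _; rewrite mul1r /stat_monomial big1 // => i _; rewrite mnm0E.
  apply; apply: (smooth_poly_in_monomial 0 mnm0 (fun=> 1)); first by rewrite mdeg0.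
  exact: is_Coo_cst.
rewrite big_cons; elim: (a j) => [|k IHk] /=; first by rewrite add0n.
by rewrite addSn mulSn; apply: poly_multiple_partial.
Qed.

End polynomials_in_statistic.

(** * Derivatives outnumber monomials *)

(** A multinomial of degree at most [D] has its exponents in [0, D]. *)
Lemma card_bmultinom_le q D : (#|{: bmultinom q D.+1}| <= D.+1 ^ q)%N.
Proof.
have le_deg (m : bmultinom q D.+1) i : (m i < D.+1)%N.
  by apply: leq_ltn_trans (bmdeg m); rewrite mdegE (bigD1 i) //= leq_addr.
rewrite -[X in (_ <= _ ^ X)%N]card_ord -[X in (_ <= X ^ _)%N]card_ord -card_ffun.
apply: (leq_card (fun m => [ffun i => Ordinal (le_deg m i)])) => m1 m2 /ffunP E.
by apply/val_inj/mnmP => i; have := E i; rewrite !ffunE => -[].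
Qed.

(** Exponents at most [s] in [n] variables give degree at most [n * s]. *)
Lemma card_bmultinom_ge n s : (s.+1 ^ n <= #|{: bmultinom n (n * s).+1}|)%N.
Proof.
pose m (u : {ffun 'I_n -> 'I_s.+1}) := Multinom [tuple (u i : nat) | i < n].
have mE u i : m u i = u i by rewrite mnmE.
have m_deg u : (mdeg (m u) < (n * s).+1)%N.
  rewrite ltnS mdegE -[X in (_ <= X * _)%N]card_ord -sum_nat_const.
  by apply: leq_sum => i _; rewrite mE -ltnS.
rewrite -[X in (_ ^ X <= _)%N]card_ord -[X in (X ^ _ <= _)%N]card_ord -card_ffun.
apply: (leq_card (fun u => BMultinom (m_deg u))) => u1 u2.
move=> /(congr1 (@bmnm _ _)) /= E.
by apply/ffunP => i; apply/val_inj; rewrite /= -!mE E.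
Qed.

(** With [r = n * s] the two counts are at least [s.+1 ^ q.+1] and at most
[(A * s.+1) ^ q], where [A = n * p + 1]; the choice [s = A ^ q] separates them. *)
Lemma more_derivatives_than_monomials n q p : (q < n)%N ->
  exists r, (#|{: bmultinom q (r * p).+1}| < #|{: bmultinom n r.+1}|)%N.
Proof.
move=> qn; set A := (n * p).+1; exists (n * A ^ q)%N; set s := (A ^ q)%N.
apply: leq_ltn_trans (card_bmultinom_le _ _) _.
apply: leq_trans (card_bmultinom_ge _ _).
apply: (@leq_trans (s.+1 ^ q.+1)); last exact: leq_pexp2l.
apply: (@leq_ltn_trans ((A * s.+1) ^ q)).
  have le_base : ((n * s * p).+1 <= A * s.+1)%N.
    by rewrite mulnS mulSn mulnAC /A addSn ltnS addnA leq_addl.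
  by case: (q) => [|q0]; rewrite ?expn0 ?leq_exp2r.
by rewrite expnMn expnS ltn_mul2r ltnSn expn_gt0.
Qed.

Theorem proposition2 (R : realType) (d1 d2 : nat)
    (X : set (borel_rV R d1)) (lambda : {measure set (borel_rV R d1) -> \bar R})
    (Theta : set 'rV[R]_d2) (f : 'rV[R]_d1 -> 'rV[R]_d2 -> R)
    (q p : nat) (S : 'rV[R]_d1 -> 'rV[R]_q) :
  sample_space X lambda ->
  parameter_space Theta ->
  is_kernel X lambda Theta f ->
  has_polynomial_score X Theta f S p ->
  (q < d2)%N ->
  exists U : set 'rV[R]_d2,
    [/\ U !=set0, open U, U `<=` Theta° & satisfies_param_pde X lambda U f].
Proof.
move=> _ [_ _ Theta0] [_ _ f_int1].
move=> [_ f_smooth f_gt0 [P [P_deg P_smooth P_score]]] q_d2.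
have Theta_open : open Theta° by exact: open_interior.
(* The kernel could not integrate to 1 over an empty sample space. *)
have [x0 Xx0] : X !=set0.
  apply/set0P/eqP => X0; have [t /interior_subset Tt] := Theta0.
  move: (f_int1 t Tt); rewrite X0 integral_set0 => /esym/eqP.
  by rewrite onee_eq0.
have f_score j : exists2 h, smooth_poly_in X S Theta° p h &
    forall x t, X x -> Theta° t -> partial j (f x) t = f x t * h x t.
  exists (fun x t => meval (fun i => S x 0 i) (P j t)) => [|x t Xx Tt].
    exists (fun m t => mcoeff m (P j t)) => // x t Xx Tt.
    rewrite {1}(mpolywE (P_deg j t Tt)) raddf_sum /=; apply: eq_bigr => m _.
    by rewrite mevalZ mevalX.
  by rewrite -P_score // mulrC divfK // gt_eqF ?f_gt0.
have [r r_large] := more_derivatives_than_monomials d2 q p q_d2.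
have /choice [Q QP] : forall a : bmultinom d2 r.+1,
    exists c : multinom q -> 'rV[R]_d2 -> R, (forall m, is_Coo Theta° (c m)) /\
      forall x t, X x -> Theta° t -> mpartial a (f x) t =
        f x t * \sum_(m : bmultinom q (r * p).+1) c m t * stat_monomial S m x.
  move=> a.
  have [h hP fE] :=
    poly_multiple_mpartial X S Theta° Theta_open f p f_smooth f_score a.
  have /(smooth_poly_inW X S Theta° Theta_open _ (r * p)) : (mdeg a * p <= r * p)%N.
    by rewrite leq_mul2r -ltnS bmdeg orbT.
  move=> /(_ _ hP) [c cU hE]; exists c; split=> // x t Xx Tt.
  by rewrite fE // hE.
pose monomials := [set: bmultinom q (r * p).+1]%SET.
pose derivatives := [set: bmultinom d2 r.+1]%SET.
have card_lt : (#|monomials| < #|derivatives|)%N by rewrite !cardsT.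
have [U [c [Uo UT cU [a0 [t0 [_ Ut0 ca0]]] cQ]]] :=
  smooth_dependence _ _ (fun a (m : bmultinom q (r * p).+1) => Q a m)
    derivatives monomials Theta° Theta_open Theta0 (fun a m => (QP a).1 m)
    card_lt.
have pde x t : X x -> U t -> \sum_a c a t * mpartial a (f x) t = 0.
  move=> Xx Ut; have Tt := UT _ Ut.
  under eq_bigr => a _ do rewrite (QP a).2 // mulrCA mulr_sumr.
  rewrite -mulr_sumr exchange_big /= big1 ?mulr0 // => m _.
  under eq_bigr => a _ do rewrite mulrA.
  rewrite -mulr_suml; have := cQ t m Ut (finset.in_setT m).
  by under eq_bigl => a do rewrite finset.in_setT; move=> ->; rewrite mul0r.
exists U; split=> //; first by exists t0.
pose L := @ParamDiffOp _ _ U r c (fun a => cU a (mdeg a)).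
exists r, L; split; last first.
  apply: aeW => x Xx; split=> [|t Ut]; last exact: pde.
  exact: is_Ck_sub UT (f_smooth x Xx r).
(* If all the coefficients of positive order vanished, the equation at [x0] and [t0] would
   read [c a0 t0 * f x0 t0 = 0] with [a0] of order zero, contrary to the positivity of [f]. *)
apply: contrapT => c_triv.
have c_null (a : bmultinom d2 r.+1) : (1 <= mdeg a)%N -> c a t0 = 0.
  move=> a_gt0; apply/eqP/negPn/negP => ca; apply: c_triv.
  by exists a; split=> //; exists t0.
have /eqP := pde x0 t0 Xx0 Ut0.
have a00 : mdeg a0 = 0%N.
  by apply/eqP; rewrite -leqn0 leqNgt; apply: contra ca0 => /c_null ->.
rewrite (bigD1 a0) //= big1 => [|a aa0]; last first.
  rewrite c_null ?mul0r // lt0n; apply: contra aa0 => a_0; apply/eqP/val_inj.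
  by move/eqP: a00; rewrite mdeg_eq0 => /eqP /= ->; apply/eqP; rewrite -mdeg_eq0.
rewrite addr0 mulf_eq0 (negbTE ca0) /=.
have -> : mpartial a0 (f x0) = f x0.
  rewrite /mpartial; have -> : bmnm a0 = mnm0 by apply/eqP; rewrite -mdeg_eq0 a00.
  by elim: (enum _) => //= j s ->; rewrite mnm0E.
by rewrite gt_eqF // f_gt0 //; apply: UT.
Qed.
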